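(* Let $M$ be a finite-$\mathcal{J}$-above finitely presented inverse monoid. Then $M$ has solvable word problem.
   Context: A monoid $M$ is inverse if for every $a\in M$ there is a unique $b\in M$ with $aba=a$ and $bab=b$ (denoted $b=a^{-1}$). For a set $A$ put $\widetilde{A}=A\cup A^{-1}$, with $A^{-1}$ a set of formal inverses, and extend $^{-1}$ to an involution of the free monoid $\widetilde{A}^*$ by $1^{-1}=1$, $(uv)^{-1}=v^{-1}u^{-1}$. Let $\rho_A$ be the congruence on $\widetilde{A}^*$ generated by all pairs $(ww^{-1}w,w)$ and $(uu^{-1}vv^{-1},vv^{-1}uu^{-1})$ with $u,v,w\in\widetilde{A}^*$. The inverse monoid defined by $\mathrm{Inv}\langle A\mid R\rangle$, $R\subseteq\widetilde{A}^*\times\widetilde{A}^*$, is $\widetilde{A}^*/(\rho_A\cup R)^\sharp$, where $^\sharp$ denotes the generated congruence. ''Finitely presented inverse monoid'' means an inverse monoid having such a presentation with $A,R$ finite (not necessarily a finite monoid presentation). For $u,v\in M$, $u$ is a factor of $v$ if $v=xuy$ for some $x,y\in M$. $M$ is finite-$\mathcal{J}$-above if every element of $M$ has only finitely many factors. *)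

(* Defs.v *)
From HB Require Import structures.
From mathcomp Require Import all_boot.
From mathcomp Require Import generic_quotient.
From mathcomp Require Import boolp classical_sets cardinality.

Set Implicit Arguments.
Unset Strict Implicit.
Unset Printing Implicit Defensive.

Local Open Scope group_scope.

(** * Inverse monoids *)

Definition mutually_inverse (M : monoidType) (a b : M) : Prop :=
  a * b * a = a /\ b * a * b = b.

Definition inverse_monoid (M : monoidType) : Prop :=
  forall a : M, exists! b : M, mutually_inverse a b.

Definition factor (M : monoidType) (u v : M) : Prop :=
  exists x y : M, v = x * u * y.

Definition finite_J_above (M : monoidType) : Prop :=
  forall v : M, finite_set [set u | factor u v]%classic.

(** * Words over an alphabet with formal inverses *)

(** The letter [(a, false)] stands for [a], and [(a, true)] for its formal
    inverse. *)
Definition letter (A : finType) : Type := (A * bool)%type.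
HB.instance Definition _ (A : finType) := Finite.on (letter A).

Definition linv (A : finType) (x : letter A) : letter A := (x.1, ~~ x.2).

Definition word (A : finType) : Type := seq (letter A).
HB.instance Definition _ (A : finType) := Countable.on (word A).
HB.instance Definition _ (A : finType) :=
  isMonoid.Build (word A) (@catA (letter A)) (@cat0s (letter A)) (@cats0 (letter A)).

Definition winv (A : finType) (w : word A) : word A := rev (map (@linv A) w).

Lemma winv1 (A : finType) : winv (1 : word A) = 1.
Proof. by []. Qed.

Lemma winvM (A : finType) (u v : word A) : winv (u * v) = winv v * winv u.
Proof. by rewrite /winv /= map_cat rev_cat. Qed.

Lemma winvK (A : finType) : involutive (@winv A).
Proof.
move=> w; rewrite /winv map_rev revK -map_comp -[RHS]map_id.
by apply: eq_map => -[a b]; rewrite /linv /= negbK.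
Qed.

(** * Presentations of inverse monoids *)

Section Congruence.
Variables (M : monoidType) (S : M -> M -> Prop).

Inductive congruence_closure : M -> M -> Prop :=
| cc_base u v : S u v -> congruence_closure u v
| cc_refl u : congruence_closure u u
| cc_sym u v : congruence_closure u v -> congruence_closure v u
| cc_trans u v w :
    congruence_closure u v -> congruence_closure v w -> congruence_closure u w
| cc_mul u u' v v' :
    congruence_closure u u' -> congruence_closure v v' ->
    congruence_closure (u * v) (u' * v').

End Congruence.

Inductive vagner_pair (A : finType) : word A -> word A -> Prop :=
| vagner_regular (w : word A) : vagner_pair (w * winv w * w) w
| vagner_commute (u v : word A) :
    vagner_pair (u * winv u * (v * winv v)) (v * winv v * (u * winv u)).

Definition rho (A : finType) : word A -> word A -> Prop :=
  congruence_closure (@vagner_pair A).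

Section Presentation.
Variables (A : finType) (R : word A -> word A -> Prop).

Definition inv_cong : word A -> word A -> Prop :=
  congruence_closure (fun u v => rho u v \/ R u v).

Definition inv_congb (u v : word A) : bool := `[< inv_cong u v >].

Lemma inv_congb_refl : reflexive inv_congb.
Proof. by move=> u; apply/asboolP; apply: cc_refl. Qed.

Lemma inv_congb_sym : symmetric inv_congb.
Proof. by move=> u v; apply/asboolP/asboolP; apply: cc_sym. Qed.

Lemma inv_congb_trans : transitive inv_congb.
Proof.
by move=> v u w /asboolP uv /asboolP vw; apply/asboolP; apply: cc_trans uv vw.
Qed.

Canonical inv_cong_equiv :=
  EquivRel inv_congb inv_congb_refl inv_congb_sym inv_congb_trans.

Local Open Scope quotient_scope.

Definition Inv : Type := {eq_quot inv_cong_equiv}.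
HB.instance Definition _ := Choice.on Inv.
HB.instance Definition _ := EqQuotient.on Inv.

Definition inv_class (w : word A) : Inv := \pi_Inv w.

Lemma inv_classP (u v : word A) : inv_class u = inv_class v <-> inv_cong u v.
Proof.
split=> [/eqquotP/asboolP //|uv].
by apply/eqquotP/asboolP.
Qed.

Lemma inv_class_surj (m : Inv) : exists w, inv_class w = m.
Proof. by exists (repr m); rewrite /inv_class reprK. Qed.

Definition inv_mul (m n : Inv) : Inv := inv_class (repr m * repr n).

Lemma inv_mul_class (u v : word A) :
  inv_mul (inv_class u) (inv_class v) = inv_class (u * v).
Proof.
by apply/inv_classP/cc_mul; apply/inv_classP; rewrite /inv_class reprK.
Qed.

Lemma inv_mulA : associative inv_mul.
Proof.
move=> a b c.
have [u <-] := inv_class_surj a; have [v <-] := inv_class_surj b.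
by have [w <-] := inv_class_surj c; rewrite !inv_mul_class mulgA.
Qed.

Lemma inv_mul1 : left_id (inv_class 1) inv_mul.
Proof. by move=> a; have [u <-] := inv_class_surj a; rewrite inv_mul_class mul1g. Qed.

Lemma inv_mulr1 : right_id (inv_class 1) inv_mul.
Proof. by move=> a; have [u <-] := inv_class_surj a; rewrite inv_mul_class mulg1. Qed.

HB.instance Definition _ := isMonoid.Build Inv inv_mulA inv_mul1 inv_mulr1.

End Presentation.

Definition monoid_isomorphic (M N : monoidType) : Prop :=
  exists f : UMagmaMorphism.type M N, bijective f.

Definition finitely_presented_inverse_monoid (M : monoidType) : Prop :=
  inverse_monoid M /\
  exists (A : finType) (R : seq (word A * word A)),
    monoid_isomorphic (Inv (fun u v => (u, v) \in R)) M.

(** * Recursive functions *)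

(** The total recursive functions: primitive recursion plus minimization
    restricted to regular functions. Each clause determines its function only
    up to pointwise equality. *)
Inductive recursive : forall k, (k.-tuple nat -> nat) -> Prop :=
| recursive_zero k (f : k.-tuple nat -> nat) :
    (forall v, f v = 0%N) -> recursive f
| recursive_succ (f : 1.-tuple nat -> nat) :
    (forall v, f v = (tnth v ord0).+1) -> recursive f
| recursive_proj k (i : 'I_k) (f : k.-tuple nat -> nat) :
    (forall v, f v = tnth v i) -> recursive f
| recursive_comp k m (h : m.-tuple nat -> nat) (g : 'I_m -> k.-tuple nat -> nat)
    (f : k.-tuple nat -> nat) :
    recursive h -> (forall i, recursive (g i)) ->
    (forall v, f v = h [tuple g i v | i < m]) -> recursive f
| recursive_primrec k (g : k.-tuple nat -> nat) (h : k.+2.-tuple nat -> nat)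
    (f : k.+1.-tuple nat -> nat) :
    recursive g -> recursive h ->
    (forall v, f (cons_tuple 0%N v) = g v) ->
    (forall n v, f (cons_tuple n.+1 v)
                 = h (cons_tuple n (cons_tuple (f (cons_tuple n v)) v))) ->
    recursive f
| recursive_min k (g : k.+1.-tuple nat -> nat) (f : k.-tuple nat -> nat) :
    recursive g ->
    (forall v, g (cons_tuple (f v) v) = 0%N) ->
    (forall v y, (y < f v)%N -> g (cons_tuple y v) <> 0%N) ->
    recursive f.

(** * The word problem *)

(** [CodeSeq.code] is the explicit bijection from [seq nat] to [nat] sending
    [n1, ..., nk] to the number with binary expansion
    [1 0^nk ... 1 0^n1]. The numbering of the finite alphabet is irrelevant. *)
Definition word_code (X : finType) (w : word X) : nat :=
  CodeSeq.code [seq nat_of_ord (enum_rank x) | x <- w].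

(** Homomorphisms exhibiting [M] as generated, as an inverse monoid, by the
    images of the elements of [X]. *)
Definition generating (X : finType) (M : monoidType)
    (phi : UMagmaMorphism.type (word X) M) : Prop :=
  (forall x : X, mutually_inverse (phi [:: (x, false)]) (phi [:: (x, true)])) /\
  (forall m : M, exists w : word X, phi w = m).

Definition word_problem_recursive (X : finType) (M : monoidType)
    (phi : UMagmaMorphism.type (word X) M) : Prop :=
  exists chi : 2.-tuple nat -> nat,
    recursive chi /\
    forall u v : word X,
      chi [tuple word_code u; word_code v] = (phi u == phi v) :> nat.

(** Meaningful for finitely generated [M]; solvability does not depend on the
    finite generating set, and is required here for all of them. *)
Definition solvable_word_problem (M : monoidType) : Prop :=
  forall (X : finType) (phi : UMagmaMorphism.type (word X) M),
    generating phi -> word_problem_recursive phi.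

(* Main.v *)
Require Import Defs.
From mathcomp Require Import all_boot.
From mathcomp Require Import boolp classical_sets cardinality.

(** McKinsey's argument. Equality in [M] is witnessed by a finite rewriting
    sequence. If [u <> v] in [M], then one of the states [x = u u^-1],
    [x = v v^-1] separates them in the following finite automaton: the states
    are the factors of [x], and a letter [a] maps [y] to [y a] when
    [y a a^-1 = y] and is undefined otherwise. The letters [a] and [a^-1] then
    act by mutually inverse partial injections, and any such action satisfies
    the Vagner relations; so a finite automaton of this kind which satisfies [R]
    and separates [u] from [v] is a checkable witness of inequality. Searching
    for a witness of either kind decides the word problem. *)

Set Implicit Arguments.
Unset Strict Implicit.
Unset Printing Implicit Defensive.

(** * Closure properties of the recursive functions *)

(** The composition clause speaks of any pointwise equal function, so it suffices to compose [f]
    with the tuple of all projections. *)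
Lemma recursive_ext k (f g : k.-tuple nat -> nat) :
  recursive f -> f =1 g -> recursive g.
Proof.
move=> rf fg; apply: (recursive_comp (g := fun i v => tnth v i) rf).
  by move=> i; apply: recursive_proj.
by move=> v; rewrite -fg; congr f; apply: eq_from_tnth => i; rewrite tnth_mktuple.
Qed.

Definition rec1 (f : nat -> nat) : Prop :=
  recursive (fun v : 1.-tuple nat => f (nth 0 v 0)).
Definition rec2 (f : nat -> nat -> nat) : Prop :=
  recursive (fun v : 2.-tuple nat => f (nth 0 v 0) (nth 0 v 1)).
Definition rec3 (f : nat -> nat -> nat -> nat) : Prop :=
  recursive (fun v : 3.-tuple nat => f (nth 0 v 0) (nth 0 v 1) (nth 0 v 2)).

Lemma recursive_nth k i : i < k -> recursive (fun v : k.-tuple nat => nth 0 v i).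
Proof.
by move=> lt_ik; apply: (@recursive_proj k (Ordinal lt_ik)) => v; rewrite (tnth_nth 0).
Qed.

Lemma rec1_comp k h (a : k.-tuple nat -> nat) :
  rec1 h -> recursive a -> recursive (fun v => h (a v)).
Proof.
move=> rh ra; apply: (recursive_comp (g := fun=> a) rh) => // v.
by rewrite (nth_mktuple _ _ ord0).
Qed.

Lemma rec2_comp k h (a b : k.-tuple nat -> nat) :
  rec2 h -> recursive a -> recursive b -> recursive (fun v => h (a v) (b v)).
Proof.
move=> rh ra rb.
apply: (recursive_comp (g := fun i : 'I_2 => nth a [:: a; b] i) rh).
  by case=> [[|[|]]].
by move=> v; rewrite (nth_mktuple _ _ ord0) (nth_mktuple _ _ (Ordinal (isT : 1 < 2))).
Qed.

Lemma rec1_succ : rec1 succn.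
Proof. by apply: recursive_succ => v; rewrite (tnth_nth 0). Qed.

Lemma recursive_const k c : recursive (fun _ : k.-tuple nat => c).
Proof.
elim: c => [|c IHc]; first exact: recursive_zero.
exact: rec1_comp rec1_succ IHc.
Qed.

(** With [nat_rect] both equations demanded by [recursive_primrec] hold by computation. *)
Lemma rec2_primrec g h :
  rec1 g -> rec3 h ->
  rec2 (fun n x => nat_rect (fun=> nat) (g x) (fun m r => h m r x) n).
Proof. by move=> rg rh; apply: (recursive_primrec rg rh). Qed.

Lemma rec2_swap f : rec2 f -> rec2 (fun x y => f y x).
Proof. by move=> rf; apply: (rec2_comp rf); exact: recursive_nth. Qed.

(** Recursion without parameters is recursion with one dummy parameter, which is then set to 0. *)
Lemma rec1_primrec c h : rec2 h -> rec1 (fun n => nat_rect (fun=> nat) c h n).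
Proof.
move=> rh; have rc : rec1 (fun=> c) by exact: recursive_const.
have r3 : rec3 (fun m r _ => h m r) by apply: (rec2_comp rh); exact: recursive_nth.
exact: (rec2_comp (rec2_primrec rc r3) (recursive_nth _) (recursive_const 1 0)).
Qed.

Lemma rec1_ext f g : rec1 f -> f =1 g -> rec1 g.
Proof. by move=> rf fg; apply: recursive_ext rf _ => v; rewrite fg. Qed.

Lemma rec2_ext f g : rec2 f -> f =2 g -> rec2 g.
Proof. by move=> rf fg; apply: recursive_ext rf _ => v; rewrite fg. Qed.

Lemma rec1_id : rec1 id.
Proof. exact: recursive_nth. Qed.

Lemma rec2_addn : rec2 addn.
Proof.
have r3 : rec3 (fun _ r _ => r.+1).
  by apply: (rec1_comp rec1_succ); exact: recursive_nth.
apply: rec2_ext (rec2_primrec rec1_id r3) _ => n x.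
by elim: n => //= n ->; rewrite addSn.
Qed.

Lemma rec2_muln : rec2 muln.
Proof.
have r3 : rec3 (fun _ r x => x + r) by apply: (rec2_comp rec2_addn); exact: recursive_nth.
have r0 : rec1 (fun=> 0) by exact: recursive_const.
apply: rec2_ext (rec2_primrec r0 r3) _ => n x.
by elim: n => //= n ->; rewrite mulSn.
Qed.

Lemma rec1_pred : rec1 predn.
Proof.
have r2 : rec2 (fun m _ => m) by exact: recursive_nth.
by apply: rec1_ext (rec1_primrec 0 r2) _; case.
Qed.

Lemma rec2_subn : rec2 subn.
Proof.
have r3 : rec3 (fun _ r _ => r.-1).
  by apply: (rec1_comp rec1_pred); exact: recursive_nth.
apply: rec2_ext (rec2_swap (rec2_primrec rec1_id r3)) _ => n x.
by elim: x => [|x /= ->]; rewrite ?subn0 // subnS.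
Qed.

Lemma rec1_exp2 : rec1 (expn 2).
Proof.
have r2 : rec2 (fun _ r => 2 * r).
  by apply: (rec2_comp rec2_muln (recursive_const _ _)); exact: recursive_nth.
apply: rec1_ext (rec1_primrec 1 r2) _.
by elim=> //= n ->; rewrite expnS.
Qed.

(** The half of [m.+1] is [m] minus the half of [m], a recursion without case distinction. *)
Lemma rec1_half : rec1 half.
Proof.
have r2 : rec2 (fun m r => m - r) by apply: (rec2_comp rec2_subn); exact: recursive_nth.
apply: rec1_ext (rec1_primrec 0 r2) _.
by elim=> //= n ->; rewrite -[X in X - _]odd_double_half uphalf_half -addnn addnA addnK.
Qed.

Lemma rec1_odd : rec1 (fun n => odd n : nat).
Proof.
have r2 : rec2 (fun _ r => 1 - r).
  by apply: (rec2_comp rec2_subn (recursive_const _ _)); exact: recursive_nth.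
by apply: rec1_ext (rec1_primrec 0 r2) _; elim=> //= n ->; case: odd.
Qed.

Lemma rec2_iter f : rec1 f -> rec2 (fun n x => iter n f x).
Proof.
move=> rf; have r3 : rec3 (fun _ r _ => f r) by apply: (rec1_comp rf); exact: recursive_nth.
by apply: rec2_ext (rec2_primrec rec1_id r3) _ => n x; elim: n => //= n ->.
Qed.

Lemma rec1_min p :
  rec2 p -> (forall x, exists n, p n x = 0) ->
  exists2 f, rec1 f & forall x, p (f x) x = 0.
Proof.
move=> rp ex_p.
have ex_pb x : exists n, p n x == 0 by have [n p0] := ex_p x; exists n; apply/eqP.
exists (fun x => ex_minn (ex_pb x)); last by move=> x; case: ex_minnP => n /eqP.
apply: (recursive_min rp) => [v|v y] /=; first by case: ex_minnP => n /eqP.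
by case: ex_minnP => n _ min_n lt_yn /eqP /min_n; rewrite leqNgt lt_yn.
Qed.

(** The bijection for which [CodeSeq.code (a :: s) = (npair a (CodeSeq.code s)).+1]. *)
Definition npair a b := (2 ^ a * b.*2.+1).-1.
Definition nfst n := logn 2 n.+1.
Definition nsnd n := (iter (nfst n) half n.+1)./2.

Lemma npairS a b : (npair a b).+1 = 2 ^ a * b.*2.+1.
Proof. by rewrite prednK // muln_gt0 expn_gt0. Qed.

Lemma iter_half a m : iter a half (2 ^ a * m) = m.
Proof.
elim: a m => [|a IHa] m; first by rewrite mul1n.
by rewrite iterSr expnS -mulnA mul2n doubleK.
Qed.

Lemma npairK1 a b : nfst (npair a b) = a.
Proof.
rewrite /nfst npairS lognM ?expn_gt0 // pfactorK //.
by rewrite lognE dvdn2 /= odd_double addn0.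
Qed.

Lemma npairK2 a b : nsnd (npair a b) = b.
Proof. by rewrite /nsnd npairK1 npairS iter_half /= uphalf_double. Qed.

Lemma nfstsnd_iter n : odd (iter (nfst n) half n.+1).
Proof.
rewrite /nfst; have [m odd_m {2}->] := pfactor_coprime (isT : prime 2) (ltn0Sn n).
by rewrite mulnC iter_half -coprime2n.
Qed.

Lemma npair_surj n : npair (nfst n) (nsnd n) = n.
Proof.
apply: succn_inj; rewrite npairS /nsnd.
have := nfstsnd_iter n; set m := iter _ _ _ => odd_m.
have -> : m./2.*2.+1 = m by rewrite -[RHS]odd_double_half odd_m.
have [k _ def_n] := pfactor_coprime (isT : prime 2) (ltn0Sn n).
by rewrite /m /nfst {3}def_n [k * _]mulnC iter_half mulnC -def_n.
Qed.

Lemma rec2_npair : rec2 npair.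
Proof.
apply: (rec1_comp rec1_pred); apply: (rec2_comp rec2_muln).
  by apply: (rec1_comp rec1_exp2); exact: recursive_nth.
apply: (rec1_comp rec1_succ).
have r1 : rec1 double.
  have := rec2_comp rec2_addn (recursive_nth (ltn0Sn 0)) (recursive_nth (ltn0Sn 0)).
  by move/recursive_ext; apply=> v; rewrite addnn.
by apply: (rec1_comp r1); exact: recursive_nth.
Qed.

(** The exponent of 2 in [n.+1] is the least number of halvings that gives an odd number, so
    minimization finds it; after fewer halvings a factor 2 is left. *)
Lemma rec1_nfst : rec1 nfst.
Proof.
apply: (@recursive_min _ (fun v => 1 - odd (iter (nth 0 v 0) half (nth 0 v 1).+1))).
- apply: (rec2_comp rec2_subn (recursive_const _ _)); apply: (rec1_comp rec1_odd).
  apply: (rec2_comp (rec2_iter rec1_half)); first exact: recursive_nth.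
  by apply: (rec1_comp rec1_succ); exact: recursive_nth.
- by move=> v /=; rewrite nfstsnd_iter.
move=> v y /=; set n := nth 0 v 0 => lt_y.
rewrite -(npair_surj n) npairS -(subnKC lt_y) addSnnS expnD -mulnA iter_half.
by rewrite expnS -mulnA mul2n odd_double.
Qed.

Lemma rec1_nsnd : rec1 nsnd.
Proof.
apply: (rec1_comp rec1_half); apply: (rec2_comp (rec2_iter rec1_half)).
  exact: rec1_nfst.
exact: rec1_succ.
Qed.

(** * Recursive functions between coded types *)

(** Under truncated subtraction, [1 - b n] and [1 - (1 - b n)] are the indicators of the two
    cases. *)
Lemma rec1_if b f g :
  rec1 b -> rec1 f -> rec1 g -> rec1 (fun n => if b n == 0 then f n else g n).
Proof.
move=> rb rf rg.
have r1 : rec1 (fun n => (1 - b n) * f n).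
  by apply: (rec2_comp rec2_muln) => //; apply: (rec2_comp rec2_subn (recursive_const _ _)).
have r2 : rec1 (fun n => (1 - (1 - b n)) * g n).
  apply: (rec2_comp rec2_muln) => //; apply: (rec2_comp rec2_subn (recursive_const _ _)).
  by apply: (rec2_comp rec2_subn (recursive_const _ _)).
have r3 : rec1 (fun n => (1 - b n) * f n + (1 - (1 - b n)) * g n).
  exact: (rec2_comp rec2_addn r1 r2).
apply: rec1_ext r3 _ => n.
by case: (b n) => [|m]; rewrite ?subSS ?sub0n ?mul1n ?mul0n ?subn0 ?mul1n ?addn0.
Qed.

(** Codings may miss numbers, as those of [bool] and [letter A] do. Surjectivity is the separate
    condition [enc_surj], imposed where a search is run. *)
Class coded (T : Type) := Coded { enc : T -> nat; enc_inj : injective enc }.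

#[refine] Instance coded_nat : coded nat := @Coded nat id _.
Proof. by move=> ? ?. Defined.

#[refine] Instance coded_bool : coded bool := @Coded _ nat_of_bool _.
Proof. by case=> [] []. Defined.

#[refine] Instance coded_prod T U (cT : coded T) (cU : coded U) : coded (T * U) :=
  @Coded _ (fun p => npair (enc p.1) (enc p.2)) _.
Proof.
move=> [a b] [c d] /= e; congr pair.
  by apply: enc_inj; rewrite -(npairK1 (enc a) (enc b)) e npairK1.
by apply: enc_inj; rewrite -(npairK2 (enc a) (enc b)) e npairK2.
Defined.

#[refine] Instance coded_seq T (cT : coded T) : coded (seq T) :=
  @Coded _ (fun s => CodeSeq.code (map enc s)) _.
Proof. by move=> s t /(can_inj CodeSeq.codeK) /(inj_map enc_inj). Defined.

#[refine] Instance coded_letter (A : finType) : coded (letter A) :=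
  @Coded _ (fun a => nat_of_ord (enum_rank a)) _.
Proof. by move=> a b /ord_inj /enum_rank_inj. Defined.

Lemma enc_cons T (cT : coded T) (a : T) s : enc (a :: s) = (npair (enc a) (enc s)).+1.
Proof. by rewrite npairS. Qed.

Lemma enc_seq_eq0 T (cT : coded T) (s : seq T) : (enc s == 0) = nilp s.
Proof. by case: s => // a s; rewrite enc_cons. Qed.

(** Nothing is required of [F] outside the range of [enc]. *)
Definition computable T U (cT : coded T) (cU : coded U) (f : T -> U) : Prop :=
  exists2 F, rec1 F & forall x, F (enc x) = enc (f x).
Arguments computable {T U cT cU} f.

Section Basic.
Context {T U V : Type} {cT : coded T} {cU : coded U} {cV : coded V}.

Lemma computable_ext (f g : T -> U) : computable f -> f =1 g -> computable g.
Proof. by move=> [F rF FE] fg; exists F => // x; rewrite FE fg. Qed.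

Lemma computable_id : computable (fun x : T => x).
Proof. by exists id => //; exact: rec1_id. Qed.

Lemma computable_const (c : U) : computable (fun _ : T => c).
Proof. by exists (fun=> enc c) => //; exact: recursive_const. Qed.

Lemma computable_comp (g : U -> V) (f : T -> U) :
  computable g -> computable f -> computable (fun x => g (f x)).
Proof.
move=> [G rG GE] [F rF FE]; exists (fun n => G (F n)); first exact: (rec1_comp rG rF).
by move=> x; rewrite FE GE.
Qed.

Lemma computable_pair (f : T -> U) (g : T -> V) :
  computable f -> computable g -> computable (fun x => (f x, g x)).
Proof.
move=> [F rF FE] [G rG GE]; exists (fun n => npair (F n) (G n)).
  exact: (rec2_comp rec2_npair rF rG).
by move=> x; rewrite FE GE.
Qed.

Lemma computable_fst (f : T -> U * V) : computable f -> computable (fun x => (f x).1).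
Proof.
move=> [F rF FE]; exists (fun n => nfst (F n)); first exact: (rec1_comp rec1_nfst rF).
by move=> x; rewrite FE /= npairK1.
Qed.

Lemma computable_snd (f : T -> U * V) : computable f -> computable (fun x => (f x).2).
Proof.
move=> [F rF FE]; exists (fun n => nsnd (F n)); first exact: (rec1_comp rec1_nsnd rF).
by move=> x; rewrite FE /= npairK2.
Qed.

Lemma computable_if (b : T -> bool) (f g : T -> U) :
  computable b -> computable f -> computable g ->
  computable (fun x => if b x then f x else g x).
Proof.
move=> [B rB BE] [F rF FE] [G rG GE].
exists (fun n => if B n == 0 then G n else F n); first exact: rec1_if.
by move=> x; rewrite BE FE GE; case: (b x).
Qed.

Lemma computable_succ (f : T -> nat) : computable f -> computable (fun x => (f x).+1).
Proof.
move=> [F rF FE]; exists (fun n => (F n).+1); first exact: (rec1_comp rec1_succ rF).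
by move=> x; rewrite FE.
Qed.

Lemma computable_enc (f : T -> U) : computable f -> computable (fun x => enc (f x)).
Proof. by move=> [F rF FE]; exists F. Qed.

End Basic.

Section Control.
Context {T U V : Type} {cT : coded T} {cU : coded U} {cV : coded V}.

Lemma computable_letter (A : finType) (g : letter A -> U) (f : T -> letter A) :
  computable f -> computable (fun x => g (f x)).
Proof.
apply: computable_comp.
(* Every function on a finite alphabet is a lookup in a constant table; the induction is on that
   table. *)
exists (nth 0 [seq enc (g a) | a <- enum {: letter A}]).
  elim: map => [|c s IHs].
    by apply: rec1_ext (recursive_const _ 0) _ => n; rewrite nth_nil.
  have r : rec1 (fun n => if n == 0 then c else nth 0 s n.-1).
    by apply: (rec1_if rec1_id (recursive_const _ c)); exact: (rec1_comp IHs rec1_pred).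
  by apply: rec1_ext r _; case.
move=> a; rewrite (nth_map a) ?nth_enum_rank //=.
by rewrite -cardE ltn_ord.
Qed.

Lemma computable_iter (f : T -> U -> U) (n : T -> nat) (z : T -> U) :
  computable (fun p : T * U => f p.1 p.2) -> computable n -> computable z ->
  computable (fun x => iter (n x) (f x) (z x)).
Proof.
move=> [F rF FE] [N rN NE] [Z rZ ZE].
(* [rec2_iter] iterates a function of the state alone, so the state carries the code of the
   parameter [x] along. *)
pose G m := npair (nfst m) (F m).
exists (fun m => nsnd (iter (N m) G (npair m (Z m)))).
  apply: (rec1_comp rec1_nsnd); apply: (rec2_comp (rec2_iter _) rN).
    exact: (rec2_comp rec2_npair rec1_nfst rF).
  exact: (rec2_comp rec2_npair rec1_id rZ).
move=> x; rewrite NE ZE.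
have -> : iter (n x) G (npair (enc x) (enc (z x))) = enc (x, iter (n x) (f x) (z x)).
  by elim: (n x) => // m IHm; rewrite iterS IHm /G FE /= npairK1.
by rewrite /= npairK2.
Qed.

Lemma computable_case (s : T -> seq U) (f : T -> V) (g : T -> U -> seq U -> V) :
  computable s -> computable f ->
  computable (fun p : T * (U * seq U) => g p.1 p.2.1 p.2.2) ->
  computable (fun x => if s x is a :: s' then g x a s' else f x).
Proof.
move=> [S rS SE] [F rF FE] [G rG GE].
(* Only the empty list has code 0; otherwise the predecessor of the code is the pair of head and
   tail. *)
exists (fun n => if S n == 0 then F n else G (npair n (S n).-1)).
  apply: rec1_if => //; apply: (rec1_comp rG).
  by apply: (rec2_comp rec2_npair rec1_id); apply: (rec1_comp rec1_pred).
move=> x; rewrite SE FE enc_seq_eq0; case: (s x) => // a s' /=.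
by rewrite -(GE (x, (a, s'))) -[_ * _]npairS.
Qed.

End Control.

(** * Arithmetic, lists and Boolean tests *)

Lemma computable_subn T (cT : coded T) (f g : T -> nat) :
  computable f -> computable g -> computable (fun x => f x - g x).
Proof.
move=> [F rF FE] [G rG GE]; exists (fun n => F n - G n).
  exact: (rec2_comp rec2_subn rF rG).
by move=> x; rewrite FE GE.
Qed.

Lemma computable_eq T (U : eqType) (cT : coded T) (cU : coded U) (f g : T -> U) :
  computable f -> computable g -> computable (fun x => f x == g x).
Proof.
move=> [F rF FE] [G rG GE].
(* Two codes agree when both truncated differences vanish, and codes are injective. *)
exists (fun n => 1 - ((F n - G n) + (G n - F n))).
  apply: (rec2_comp rec2_subn (recursive_const _ _)).
  by apply: (rec2_comp rec2_addn); apply: (rec2_comp rec2_subn).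
move=> x; rewrite FE GE -(inj_eq enc_inj) eqn_leq /leq /=.
by case: (enc (f x) - _) => [|?]; case: (enc (g x) - _).
Qed.

Lemma computable_cons T U (cT : coded T) (cU : coded U) (f : T -> U) (s : T -> seq U) :
  computable f -> computable s -> computable (fun x => f x :: s x).
Proof.
move=> [F rF FE] [S rS SE]; exists (fun n => (npair (F n) (S n)).+1).
  by apply: (rec1_comp rec1_succ); apply: (rec2_comp rec2_npair).
by move=> x; rewrite FE SE enc_cons.
Qed.

Lemma computable_foldl T U V (cT : coded T) (cU : coded U) (cV : coded V)
    (f : T -> V -> U -> V) (z : T -> V) (s : T -> seq U) :
  computable (fun p : T * (V * U) => f p.1 p.2.1 p.2.2) ->
  computable z -> computable s ->
  computable (fun x => foldl (f x) (z x) (s x)).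
Proof.
move=> cf cz cs.
pose step x (p : seq U * V) := if p.1 is a :: s' then (s', f x p.2 a) else p.
have cstep : computable (fun p => step p.1 p.2).
  apply: (computable_case (s := fun p : T * (seq U * V) => p.2.1) (f := snd)
           (g := fun p a s' => (s', f p.1 p.2.2 a))).
  - exact/computable_fst/computable_snd/computable_id.
  - exact/computable_snd/computable_id.
  apply: computable_pair; first exact/computable_snd/computable_snd/computable_id.
  apply: (computable_comp (g := fun p : T * (V * U) => f p.1 p.2.1 p.2.2)
    (f := fun p : T * (seq U * V) * (U * seq U) => (p.1.1, (p.1.2.2, p.2.1))) cf).
  apply: computable_pair; first exact/computable_fst/computable_fst/computable_id.
  apply: computable_pair.
    exact/computable_snd/computable_snd/computable_fst/computable_id.
  exact/computable_fst/computable_snd/computable_id.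
(* The code of the list serves as the number of iterations: it bounds the size, and [step] is idle
   once the list is used up. *)
have := computable_snd (computable_iter cstep (computable_enc cs) (computable_pair cs cz)).
move/computable_ext; apply=> x.
have : size (s x) <= enc (s x).
  elim: (s x) => // a s' IHs; rewrite enc_cons /= ltnS (leq_trans IHs) //.
  rewrite -ltnS npairS (leq_trans _ (leq_pmull _ _)) ?expn_gt0 // ltnS -addnn.
  exact: leq_addr.
move: (enc (s x)) => n; elim: n (s x) (z x) => [|n IHn] [|a s'] y //; first by rewrite iterSr IHn.
by move=> le_s; rewrite iterSr IHn.
Qed.

Lemma computable_catrev T U (cT : coded T) (cU : coded U) (s t : T -> seq U) :
  computable s -> computable t -> computable (fun x => catrev (s x) (t x)).
Proof.
move=> cs ct; apply: computable_ext (computable_foldl (f := fun _ r a => a :: r) _ ct cs) _.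
  apply: computable_cons; first exact/computable_snd/computable_snd/computable_id.
  exact/computable_fst/computable_snd/computable_id.
by move=> x; elim: (s x) (t x) => /=.
Qed.

Lemma computable_rev T U (cT : coded T) (cU : coded U) (s : T -> seq U) :
  computable s -> computable (fun x => rev (s x)).
Proof. by move=> cs; apply: computable_catrev (computable_const _). Qed.

Lemma computable_cat T U (cT : coded T) (cU : coded U) (s t : T -> seq U) :
  computable s -> computable t -> computable (fun x => s x ++ t x).
Proof.
move=> cs ct; apply: computable_ext (computable_catrev (computable_rev cs) ct) _ => x.
by rewrite catrevE revK.
Qed.

Lemma computable_map T U V (cT : coded T) (cU : coded U) (cV : coded V)
    (f : T -> U -> V) (s : T -> seq U) :
  computable (fun p : T * U => f p.1 p.2) -> computable s ->
  computable (fun x => [seq f x a | a <- s x]).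
Proof.
move=> cf cs; have c0 : computable (fun _ : T => [::] : seq V) by exact: computable_const.
have cr : computable (fun x => rev (foldl (fun r a => f x a :: r) [::] (s x))).
  apply: computable_rev; apply: (computable_foldl (f := fun x r a => f x a :: r)) => //.
  apply: computable_cons; last exact/computable_fst/computable_snd/computable_id.
  apply: (computable_comp (f := fun p : T * (seq V * U) => (p.1, p.2.2)) cf).
  apply: computable_pair; first exact/computable_fst/computable_id.
  exact/computable_snd/computable_snd/computable_id.
by apply: computable_ext cr _ => x; rewrite -[RHS]revK; congr rev; rewrite /rev;
   elim: (s x) [::] => /=.
Qed.

Lemma computable_flatten T U (cT : coded T) (cU : coded U) (s : T -> seq (seq U)) :
  computable s -> computable (fun x => flatten (s x)).
Proof.
move=> cs; have c0 : computable (fun _ : T => [::] : seq U) by exact: computable_const.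
apply: computable_ext (computable_foldl (f := fun _ r a => r ++ a) _ c0 cs) _ => [|x].
  apply: computable_cat; first exact/computable_fst/computable_snd/computable_id.
  exact/computable_snd/computable_snd/computable_id.
rewrite -[RHS]cat0s; elim: (s x) [::] => [|a s' IHs] r /=; first by rewrite cats0.
by rewrite IHs catA.
Qed.

Lemma computable_andb T (cT : coded T) (b c : T -> bool) :
  computable b -> computable c -> computable (fun x => b x && c x).
Proof. by move=> cb cc; apply: computable_if => //; apply: computable_const. Qed.

Lemma computable_orb T (cT : coded T) (b c : T -> bool) :
  computable b -> computable c -> computable (fun x => b x || c x).
Proof. by move=> cb cc; apply: computable_if => //; apply: computable_const. Qed.

Lemma computable_negb T (cT : coded T) (b : T -> bool) :
  computable b -> computable (fun x => ~~ b x).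
Proof. by move=> cb; apply: computable_if => //; apply: computable_const. Qed.

Lemma computable_leq T (cT : coded T) (f g : T -> nat) :
  computable f -> computable g -> computable (fun x => f x <= g x).
Proof. by move=> cf cg; apply: computable_eq (computable_const _); apply: computable_subn. Qed.

Lemma computable_all T U (cT : coded T) (cU : coded U)
    (p : T -> U -> bool) (s : T -> seq U) :
  computable (fun q : T * U => p q.1 q.2) -> computable s ->
  computable (fun x => all (p x) (s x)).
Proof.
move=> cp cs; have ct : computable (fun _ : T => true) by exact: computable_const.
apply: computable_ext (computable_foldl (f := fun x b a => b && p x a) _ ct cs) _ => [|x].
  apply: computable_andb; first exact/computable_fst/computable_snd/computable_id.
  apply: (computable_comp (f := fun q : T * (bool * U) => (q.1, q.2.2)) cp).
  apply: computable_pair; first exact/computable_fst/computable_id.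
  exact/computable_snd/computable_snd/computable_id.
by rewrite -[RHS]andTb; elim: (s x) true => [|a s' IHs] b /=; rewrite ?andbT // IHs andbA.
Qed.

Lemma computable_nth T U (cT : coded T) (cU : coded U)
    (d : T -> U) (s : T -> seq U) (n : T -> nat) :
  computable d -> computable s -> computable n -> computable (fun x => nth (d x) (s x) (n x)).
Proof.
move=> cd cs cn.
have cb : computable (fun t : seq U => behead t).
  apply: computable_ext (computable_case (g := fun _ _ s' => s') computable_id
    (computable_const ([::] : seq U)) _) _; last by case.
  exact/computable_snd/computable_snd/computable_id.
have cdrop : computable (fun x => drop (n x) (s x)).
  apply: computable_ext (computable_iter (f := fun _ => behead) _ cn cs) _.
    exact: (computable_comp cb (computable_snd computable_id)).
  by move=> x; elim: (n x) (s x) => [|m IHm] t; rewrite ?drop0 // iterSr IHm; case: t.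
apply: computable_ext (computable_case (g := fun _ a _ => a) cdrop cd _) _.
  exact/computable_fst/computable_snd/computable_id.
by move=> x; rewrite -[n x in RHS]addn0 -nth_drop; case: drop.
Qed.

Lemma computable_iota T (cT : coded T) (n : T -> nat) :
  computable n -> computable (fun x => iota 0 (n x)).
Proof.
move=> cn; have c0 : computable (fun _ : T => (0, [::] : seq nat)) by exact: computable_const.
apply: computable_ext (computable_snd (computable_iter
  (f := fun _ p => (p.1.+1, rcons p.2 p.1)) _ cn c0)) _ => [|x].
  have cq : computable (fun p : T * (nat * seq nat) => p.2.1).
    exact/computable_fst/computable_snd/computable_id.
  apply: computable_pair; first exact: computable_succ.
  have := computable_cat (computable_snd (computable_snd computable_id))
            (computable_cons cq (computable_const [::])).
  by move/computable_ext; apply=> p; rewrite cats1.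
suff -> : iter (n x) (fun p => (p.1.+1, rcons p.2 p.1)) (0, [::]) = (n x, iota 0 (n x)) by [].
elim: (n x) => // m IHm; rewrite iterS IHm /=.
by rewrite -[0 :: _]/(iota 0 m.+1) -addn1 iotaD cats1 addn1.
Qed.

(** * Surjective codings and unbounded search *)

Definition enc_surj T (cT : coded T) : Prop := forall n, exists x : T, enc x = n.
Arguments enc_surj T {cT}.

Lemma enc_surj_nat : enc_surj nat.
Proof. by move=> n; exists n. Qed.

Lemma enc_surj_prod T U (cT : coded T) (cU : coded U) :
  enc_surj T -> enc_surj U -> enc_surj (T * U).
Proof.
move=> sT sU n; have [x xE] := sT (nfst n); have [y yE] := sU (nsnd n).
by exists (x, y); rewrite /= xE yE npair_surj.
Qed.

Lemma enc_surj_seq T (cT : coded T) : enc_surj T -> enc_surj (seq T).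
Proof.
move=> sT n; rewrite -(CodeSeq.decodeK n) /=.
elim: (CodeSeq.decode n) => [|m s [t tE]]; first by exists [::].
by have [x <-] := sT m; exists (x :: t); rewrite /= tE.
Qed.

(** Surjectivity of the codings makes the search terminate on every input of
    the underlying numerical function, as [recursive_min] demands. *)
Lemma computable_search T C (cT : coded T) (cC : coded C) (p : C -> T -> bool) :
  enc_surj T -> enc_surj C ->
  computable (fun q : C * T => p q.1 q.2) -> (forall x, exists c, p c x) ->
  exists2 f : T -> C, computable f & forall x, p (f x) x.
Proof.
move=> sT sC [P rP PE] ex_p.
have {}PE c x : P (npair (enc c) (enc x)) = p c x := PE (c, x).
have r2 : rec2 (fun n m => 1 - P (npair n m)).
  apply: (rec2_comp rec2_subn (recursive_const _ _)); apply: (rec1_comp rP).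
  exact: rec2_npair.
have [m|F rF FE] := rec1_min r2.
  have [x <-] := sT m; have [c pcx] := ex_p x; exists (enc c).
  by rewrite PE pcx.
have f_ex x : {c | enc c = F (enc x) & p c x}.
  apply: cid2; have [c cE] := sC (F (enc x)); exists c => //.
  by have {FE} := FE (@enc T cT x); rewrite -cE PE; case: (p c x).
exists (fun x => s2val (f_ex x)); last by move=> x; case: f_ex.
by exists F => // x; case: f_ex.
Qed.

(** * Rewriting sequences and partially injective automata *)

Lemma congruence_closure_sub (M : monoidType) (S E : M -> M -> Prop) :
  (forall u v, S u v -> E u v) -> (forall u, E u u) ->
  (forall u v, E u v -> E v u) -> (forall u v w, E u v -> E v w -> E u w) ->
  (forall u u' v v', E u u' -> E v v' -> E (u * v)%g (u' * v')%g) ->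
  forall u v, congruence_closure S u v -> E u v.
Proof.
move=> sub Er Es Et Em u v; elim=> {u v} [u v|u|u v _|u v w _ Euv _|u u' v v' _ Eu _].
- exact: sub.
- exact: Er.
- exact: Es.
- exact: Et.
- exact: Em.
Qed.

Section Presentation.
Variables (A : finType) (R : seq (word A * word A)).
Local Notation word := (seq (letter A)).
Local Notation cong := (inv_cong (fun u v => (u, v) \in R)).

(** The generators of [inv_cong] include [rho], itself a generated congruence, so minimality is
    applied at both levels. *)
Lemma inv_cong_sub (E : word -> word -> Prop) :
  (forall u v, vagner_pair u v -> E u v) -> (forall u v, (u, v) \in R -> E u v) ->
  (forall u, E u u) -> (forall u v, E u v -> E v u) ->
  (forall u v w, E u v -> E v w -> E u w) ->
  (forall u u' v v', E u u' -> E v v' -> E (u ++ v) (u' ++ v')) ->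
  forall u v, cong u v -> E u v.
Proof.
move=> EV ER Er Es Et Em; apply: congruence_closure_sub => // u v [uv|/ER//].
by apply: congruence_closure_sub uv.
Qed.

Lemma cong_vagner u v : vagner_pair u v -> cong u v.
Proof. by move=> uv; apply/cc_base; left; apply: cc_base. Qed.

(** The Vagner pairs form an infinite family; once [x] and [y] are fixed the list is finite and a
    rule can be named by its index. *)
Definition word_relations (x y : word) : seq (word * word) :=
  (x ++ winv x ++ x, x) ::
  (x ++ winv x ++ y ++ winv y, y ++ winv y ++ x ++ winv x) :: R.

Definition rewriting_rules (x y : word) : seq (word * word) :=
  word_relations x y ++ [seq (lr.2, lr.1) | lr <- word_relations x y].

(** [((p, q), ((x, y), k))] rewrites a word [p l q] into [p r q], where [(l, r)]
    is the [k]-th rule for [x] and [y]; it leaves any other word unchanged. *)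
Definition rewriting_step : Type := ((word * word) * ((word * word) * nat))%type.

Definition rewrite_step (w : word) (s : rewriting_step) : word :=
  let lr := nth ([::], [::]) (rewriting_rules s.2.1.1 s.2.1.2) s.2.2 in
  if w == s.1.1 ++ lr.1 ++ s.1.2 then s.1.1 ++ lr.2 ++ s.1.2 else w.

Definition derivable u v := exists ss, foldl rewrite_step u ss = v.

Lemma rules_cong x y l r : (l, r) \in rewriting_rules x y -> cong l r.
Proof.
have base l' r' : (l', r') \in word_relations x y -> cong l' r'.
  rewrite !inE => /or3P[/eqP[-> ->]|/eqP[-> ->]|lr].
  - by apply: cong_vagner; rewrite catA; apply: vagner_regular.
  - by apply: cong_vagner; rewrite !(catA _ (winv _)); apply: vagner_commute.
  - by apply: cc_base; right.
rewrite mem_cat => /orP[/base//|/mapP[[r' l'] /base rl [-> ->]]].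
exact: cc_sym.
Qed.

Lemma rewriting_rules_sym x y l r :
  (l, r) \in rewriting_rules x y -> (r, l) \in rewriting_rules x y.
Proof.
rewrite !mem_cat => /orP[lr|/mapP[[r' l'] rl [-> ->]]]; last by rewrite rl.
by apply/orP; right; apply/mapP; exists (l, r).
Qed.

Lemma rewrite_step_cong w s : cong w (rewrite_step w s).
Proof.
rewrite /rewrite_step; set lr := nth _ _ _; case: eqP => [->|_]; last exact: cc_refl.
apply: (cc_mul (cc_refl _ _)); apply: (cc_mul _ (cc_refl _ _)).
have [lt_k|le_k] := ltnP s.2.2 (size (rewriting_rules s.2.1.1 s.2.1.2)).
  by apply: (@rules_cong s.2.1.1 s.2.1.2); rewrite -surjective_pairing mem_nth.
(* An index out of range selects the default rule, which replaces the empty word by itself. *)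
by rewrite /lr nth_default //; apply: cc_refl.
Qed.

Lemma derivable_cong u v : derivable u v -> cong u v.
Proof.
case=> ss <-{v}; elim: ss u => [|s ss IHs] u; first exact: cc_refl.
exact: cc_trans (rewrite_step_cong u s) (IHs _).
Qed.

Lemma derivable_refl u : derivable u u.
Proof. by exists [::]. Qed.

Lemma derivable_trans u v w : derivable u v -> derivable v w -> derivable u w.
Proof. by move=> [ss <-] [ts <-]; exists (ss ++ ts); rewrite foldl_cat. Qed.

Lemma derivable_rule p q x y l r :
  (l, r) \in rewriting_rules x y -> derivable (p ++ l ++ q) (p ++ r ++ q).
Proof.
move=> lr; exists [:: ((p, q), ((x, y), index (l, r) (rewriting_rules x y)))].
by rewrite /= /rewrite_step /= nth_index // eqxx.
Qed.

(** A step that fires is undone in the same context by the reversed rule; this is why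
    [rewriting_rules] holds both orientations. *)
Lemma derivable_step_sym u s : derivable (rewrite_step u s) u.
Proof.
rewrite /rewrite_step; set lr := nth _ _ _; case: eqP => [->|_]; last exact: derivable_refl.
have [lt_k|le_k] := ltnP s.2.2 (size (rewriting_rules s.2.1.1 s.2.1.2)).
  apply: (@derivable_rule _ _ s.2.1.1 s.2.1.2); apply: rewriting_rules_sym.
  by rewrite -surjective_pairing mem_nth.
by rewrite /lr nth_default //; apply: derivable_refl.
Qed.

Lemma derivable_sym u v : derivable u v -> derivable v u.
Proof.
case=> ss <-{v}; elim: ss u => [|s ss IHs] u; first exact: derivable_refl.
exact: derivable_trans (IHs _) (derivable_step_sym u s).
Qed.

Lemma derivable_context p q u v : derivable u v -> derivable (p ++ u ++ q) (p ++ v ++ q).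
Proof.
case=> ss <-{v}; elim: ss u => [|s ss IHs] u; first exact: derivable_refl.
apply: derivable_trans (IHs _) => /=.
exists [:: ((p ++ s.1.1, s.1.2 ++ q), s.2)]; rewrite /= /rewrite_step /=.
set lr := nth _ _ _; case: (u =P _) => [->|neq_u]; first by rewrite -!catA eqxx.
(* An idle step must stay idle in the longer word: if it fired there, cancelling [p] on the left and
   [q] on the right would make it fire at [u]. *)
case: eqP => // e; case: neq_u; move: e; rewrite -!catA.
move/(congr1 (drop (size p))); rewrite !drop_size_cat // !catA.
move/(congr1 (fun s => rev (drop (size q) (rev s)))).
by rewrite !rev_cat !drop_size_cat ?size_rev // -!rev_cat !revK.
Qed.

(** Derivability is a congruence containing the generating pairs, and [cong] is the least one. *)
Lemma derivableP u v : derivable u v <-> cong u v.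
Proof.
split; first exact: derivable_cong.
apply: inv_cong_sub.
- move=> _ _ [x|x y].
    change (derivable ((x ++ winv x) ++ x) x).
    have := @derivable_rule [::] [::] x x (x ++ winv x ++ x) x (mem_head _ _).
    by rewrite !cats0 !cat0s catA.
  change (derivable ((x ++ winv x) ++ y ++ winv y) ((y ++ winv y) ++ x ++ winv x)).
  have := @derivable_rule [::] [::] x y (x ++ winv x ++ y ++ winv y) (y ++ winv y ++ x ++ winv x).
  by rewrite !cats0 !cat0s -!catA; apply; rewrite !inE eqxx orbT.
- move=> x y xy; have := @derivable_rule [::] [::] [::] [::] x y.
  by rewrite !cats0 !cat0s; apply; rewrite mem_cat !inE xy !orbT.
- exact: derivable_refl.
- exact: derivable_sym.
- exact: derivable_trans.
move=> x x' y y' xx' yy'; apply: (@derivable_trans _ (x' ++ y)).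
  exact: (@derivable_context [::] y).
by have := @derivable_context x' [::] y y' yy'; rewrite !cats0.
Qed.

(** A finite automaton with states below [n] and a sink [n]; [t] lists the
    transition table of each letter. *)
Definition transition n (t : seq (seq nat)) (q : nat) (a : letter A) : nat :=
  nth n (nth [::] t (enc a)) q.

Definition run n t := foldl (transition n t).

(** Since [a] ranges over formal inverses too, [a] and [linv a] act as mutually inverse partial
    injections. The sink is tested explicitly because a row of [t] may have an entry at position
    [n]. *)
Definition partially_injective n t : bool :=
  all (fun a => (transition n t n a == n) &&
    all (fun q => (transition n t q a == n) || (transition n t q a < n) &&
           (transition n t (transition n t q a) (linv a) == q)) (iota 0 n))
    (enum {: letter A}).

Definition satisfies_relations n t : bool :=
  all (fun lr : word * word =>
         all (fun q => run n t q lr.1 == run n t q lr.2) (iota 0 n)) R.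

Section Automaton.
Variables (n : nat) (t : seq (seq nat)).
Hypothesis inj_t : partially_injective n t.
Hypothesis rel_t : satisfies_relations n t.

Lemma transition_sink a : transition n t n a = n.
Proof. by have /allP/(_ a) := inj_t; rewrite mem_enum => /(_ isT) /andP[/eqP]. Qed.

Lemma transition_inv q a : q < n ->
  (transition n t q a = n) \/
  (transition n t q a < n /\ transition n t (transition n t q a) (linv a) = q).
Proof.
have /allP/(_ a) := inj_t; rewrite mem_enum => /(_ isT) /andP[_ /allP/(_ q)].
rewrite mem_iota /= add0n => inj lt_qn.
by case/orP: (inj lt_qn) => [/eqP|/andP[lt /eqP]]; [left | right].
Qed.

Lemma run_cat q u v : run n t q (u ++ v) = run n t (run n t q u) v.
Proof. exact: foldl_cat. Qed.

Lemma run_sink w : run n t n w = n.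
Proof. by elim: w => //= a w IHw; rewrite transition_sink. Qed.

Lemma run_inv w q : q < n ->
  (run n t q w = n) \/ (run n t q w < n /\ run n t (run n t q w) (winv w) = q).
Proof.
elim: w q => [|a w IHw] q lt_qn /=; first by right.
have [->|[lt_q'n q'E]] := transition_inv a lt_qn; first by left; apply: run_sink.
have [->|[lt_rn rE]] := IHw _ lt_q'n; first by left.
right; split=> //; rewrite /winv /= rev_cons -cats1 run_cat.
by rewrite -[rev _]/(winv w) rE.
Qed.

(** The word [w ++ winv w] acts as the identity restricted to the domain of [w]. Such partial
    identities commute, which is what the Vagner relations come down to. *)
Lemma run_idempotent w q : q < n ->
  run n t q (w ++ winv w) = if run n t q w == n then n else q.
Proof.
move=> lt_qn; rewrite run_cat; have [->|[lt_rn rE]] := run_inv w lt_qn.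
  by rewrite eqxx run_sink.
by rewrite rE ltn_eqF.
Qed.

Lemma run_cong u v : cong u v -> forall q, q <= n -> run n t q u = run n t q v.
Proof.
(* The sink is included among the states, and they are closed under runs; compatibility with
   concatenation needs this for the intermediate state. *)
have le_run w q : q <= n -> run n t q w <= n.
  rewrite leq_eqVlt => /predU1P[->|lt_qn]; first by rewrite run_sink.
  by have [->|[/ltnW]] := run_inv w lt_qn.
move: u v.
apply: (@inv_cong_sub (fun u v => forall q, q <= n -> run n t q u = run n t q v)).
- move=> _ _ [w|u v] q.
    rewrite leq_eqVlt => /predU1P[->|lt_qn]; first by rewrite !run_sink.
    change (run n t q ((w ++ winv w) ++ w) = run n t q w); rewrite run_cat run_idempotent //.
    by case: eqP => // ->; rewrite run_sink.
  rewrite leq_eqVlt => /predU1P[->|lt_qn]; first by rewrite !run_sink.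
  change (run n t q ((u ++ winv u) ++ v ++ winv v) = run n t q ((v ++ winv v) ++ u ++ winv u)).
  rewrite (run_cat q (u ++ _)) (run_cat q (v ++ _)) !(run_idempotent _ lt_qn).
  by case qu: (run n t q u == n); case qv: (run n t q v == n);
     rewrite ?run_sink ?(run_idempotent _ lt_qn) ?qu ?qv.
- move=> u v uv q; rewrite leq_eqVlt => /predU1P[->|lt_qn]; first by rewrite !run_sink.
  have /allP/(_ _ uv)/allP/(_ q) := rel_t; rewrite mem_iota => /(_ lt_qn).
  by move/eqP.
- by [].
- by move=> u v uv q le_qn; rewrite uv.
- by move=> u v w uv vw q le_qn; rewrite uv ?vw.
- by move=> u u' v v' uu' vv' q le_qn; rewrite !run_cat uu' // vv' // le_run.
Qed.

End Automaton.
End Presentation.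

(** * The action of an inverse monoid on the factors of an element *)

Section Separation.
Local Open Scope group_scope.
Variables (A : finType) (R : seq (word A * word A)) (M : monoidType).
Local Notation word := (seq (letter A)).
Local Notation cong := (inv_cong (fun u v => (u, v) \in R)).
(** [P] abstracts the quotient map followed by the isomorphism onto [M]. *)
Variable P : word -> M.
Hypothesis P1 : P [::] = 1.
Hypothesis PM : forall u v, P (u ++ v) = P u * P v.
Hypothesis PE : forall u v, P u = P v <-> cong u v.

Lemma image_regular w : P w * P (winv w) * P w = P w.
Proof. by rewrite -!PM; apply/PE/cong_vagner; apply: vagner_regular. Qed.

Lemma image_commute u v :
  P u * P (winv u) * (P v * P (winv v)) = P v * P (winv v) * (P u * P (winv u)).
Proof. by rewrite -!PM; apply/PE/cong_vagner; apply: vagner_commute. Qed.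

(** The domain of the partial right action of [w]: the elements at which multiplication by [w] is
    undone by [winv w]. *)
Definition acts (x : M) (w : word) : bool := x * P w * P (winv w) == x.

(** This lets a run letter by letter agree with multiplication by a whole word. If [u ++ v] acts at
    [x], regularity of [winv u] shows that [u] does; that [v] acts at [x * P u] follows by commuting
    the idempotents of [v] and [winv u]. *)
Lemma acts_cat x u v : acts x (u ++ v) = acts x u && acts (x * P u) v.
Proof.
rewrite /acts; have -> : winv (u ++ v) = winv v ++ winv u by exact: winvM.
rewrite !PM !mulgA; apply/eqP/andP => [xE|[/eqP xu /eqP->//]].
have reg := image_regular (winv u); have comm := image_commute v (winv u).
rewrite winvK in reg comm.
have xu : x * P u * P (winv u) = x.
  by rewrite -[in LHS]xE -!mulgA (mulgA (P (winv u)) (P u)) reg !mulgA xE.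
split; apply/eqP => //.
by rewrite -[in RHS]xE -!mulgA (mulgA (P v) (P (winv v))) comm !mulgA xu.
Qed.

(** The domain of the action thus depends on the element only, not on the word. Each of the two
    idempotents absorbs the other on one side, and they commute. *)
Lemma image_range u v : P u = P v -> P u * P (winv u) = P v * P (winv v).
Proof.
move=> uv; have vu : P v * P (winv v) * (P u * P (winv u)) = P u * P (winv u).
  by rewrite mulgA uv image_regular.
rewrite -vu -image_commute mulgA -uv.
by rewrite image_regular.
Qed.

Section Automaton.
Variable s : seq M.
Hypothesis uniq_s : uniq s.
Hypothesis closed_s : forall x a, x \in s -> acts x [:: a] -> x * P [:: a] \in s.

(** States are positions in [s]; [size s], the position of no member, is the sink. *)
Definition action_table : seq (seq nat) :=
  [seq [seq (if acts x [:: a] then index (x * P [:: a]) s else size s) | x <- s]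
     | a <- enum {: letter A}].

Lemma action_transition x a : x \in s ->
  transition (size s) action_table (index x s) a =
  if acts x [:: a] then index (x * P [:: a]) s else size s.
Proof.
move=> xs; rewrite /transition /action_table (nth_map a) /= -?cardE ?ltn_ord //.
by rewrite nth_enum_rank (nth_map 1) ?index_mem // nth_index.
Qed.

Lemma action_sink (a : letter A) : transition (size s) action_table (size s) a = size s.
Proof.
rewrite /transition /action_table (nth_map a) /= -?cardE ?ltn_ord //.
by rewrite nth_default // size_map.
Qed.

Lemma action_injective : @partially_injective A (size s) action_table.
Proof.
apply/allP=> a _; rewrite action_sink eqxx; apply/allP => q.
rewrite mem_iota /= add0n => lt_q; rewrite -(index_uniq 1 lt_q uniq_s).
have := mem_nth 1 lt_q; move: (nth _ _ _) => x xs {q lt_q}.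
rewrite action_transition //; have [xa|_] := boolP (acts x [:: a]); last by rewrite eqxx.
have xas := closed_s xs xa; rewrite index_mem xas action_transition //=.
have xaE : x * P [:: a] * P [:: linv a] = x by apply/eqP.
(* The inverse letter acts at [x * P [:: a]] because it leads back to [x], from where [a]
   returns. *)
have -> : acts (x * P [:: a]) [:: linv a].
  by apply/eqP; rewrite xaE -[winv _]/(winv (winv [:: a])) winvK.
by rewrite xaE eqxx orbT.
Qed.

Lemma action_run x w : x \in s ->
  run (size s) action_table (index x s) w =
  if acts x w then index (x * P w) s else size s.
Proof.
elim: w x => [|a w IHw] x xs /=; first by rewrite /acts /= P1 !mulg1 eqxx.
rewrite action_transition // -[a :: w]cat1s acts_cat PM mulgA.
have [xa|_] /= := boolP (acts x [:: a]); first exact: IHw (closed_s xs xa).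
by apply: run_sink; exact: action_injective.
Qed.

(** The two sides of a relation have the same image, hence the same domain by [image_range] and the
    same values. *)
Lemma action_relations : satisfies_relations R (size s) action_table.
Proof.
apply/allP=> -[u v] uv; apply/allP => q.
rewrite mem_iota /= add0n => lt_q; rewrite -(index_uniq 1 lt_q uniq_s).
have uvE : P u = P v by apply/PE; apply: cc_base; right.
rewrite !action_run ?mem_nth // /acts -![_ * P _ * _]mulgA.
by rewrite (image_range uvE) uvE.
Qed.

End Automaton.

Hypothesis finite_factors : finite_J_above M.

(** From the state [x], the image of [u ++ winv u], the word [u] is defined and leads to [P u],
    again a factor of [x]. If [v] leads there too, then [x * P v = P u], so [P u] is below [P v] in
    the natural order. *)
Lemma exists_separating_state u v :
  exists n t q, [/\ @partially_injective A n t, satisfies_relations R n t, q < n &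
    run n t q u = run n t q v -> P u = P u * P (winv u) * P v].
Proof.
set x := P u * P (winv u); have /finite_seqP[s0 s0E] := finite_factors x.
pose s := undup s0; have memE y : (y \in s) = `[< factor y x >].
  rewrite mem_undup; apply/idP/asboolP => ys.
    by have : [set` s0]%classic y by []; rewrite -s0E.
  by have : [set y | factor y x]%classic y by []; rewrite s0E.
have xs : x \in s by rewrite memE; apply/asboolP; exists 1, 1; rewrite mul1g mulg1.
have closed_s y a : y \in s -> acts y [:: a] -> y * P [:: a] \in s.
  rewrite !memE => /asboolP[z1 [z2 xE]] /eqP yE; apply/asboolP.
  (* If [x = z1 * y * z2] and [a] acts at [y], inserting [a] and its inverse after [y] exhibits [y *
     P [:: a]] as a factor. *)
  by exists z1, (P (winv [:: a]) * z2); rewrite xE -{1}yE !mulgA.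
have uniq_s : uniq s by exact: undup_uniq.
exists (size s), (action_table s), (index x s); split.
- exact: action_injective.
- exact: action_relations.
- by rewrite index_mem.
have xu : x * P u = P u by exact: image_regular.
rewrite !action_run // {1}/acts xu eqxx.
have us : P u \in s.
  by rewrite memE; apply/asboolP; exists 1, (P (winv u)); rewrite mul1g.
(* If [v] were undefined at [x] its run would end in the sink, whereas [P u] is a proper state. *)
case: ifP => _ e; last by move: us; rewrite -index_mem e ltnn.
have vs : x * P v \in s by rewrite -index_mem -e index_mem.
by rewrite -(nth_index 1 us) e nth_index.
Qed.

Lemma exists_separation u v : P u <> P v ->
  exists n t q, [/\ @partially_injective A n t, satisfies_relations R n t, q < n &
    run n t q u != run n t q v].
Proof.
move=> neq_uv; have [n [t [q [it rt lt_q sep]]]] := exists_separating_state u v.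
have [euv|] := eqVneq (run n t q u) (run n t q v); last by exists n, t, q.
have [n' [t' [q' [it' rt' lt_q' sep']]]] := exists_separating_state v u.
have [evu|] := eqVneq (run n' t' q' u) (run n' t' q' v); last by exists n', t', q'.
(* If neither automaton separates, each of [P u] and [P v] is below the other in the natural order;
   commuting idempotents yields antisymmetry. *)
case: neq_uv; rewrite [LHS](sep euv) [in LHS](sep' (esym evu)) mulgA.
by rewrite image_commute -mulgA image_regular -(sep' (esym evu)).
Qed.

End Separation.

(** * Certificates *)

Ltac computes := repeat (cbv beta; first [assumption | lazymatch goal with
  | |- computable fst => exact: (computable_fst computable_id)
  | |- computable snd => exact: (computable_snd computable_id)
  | |- computable (fun _ => ?c) => exact: computable_const
  | |- computable (fun x => (_, _)) => apply: computable_pair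
  | |- computable (fun x => fst _) => apply: computable_fst
  | |- computable (fun x => snd _) => apply: computable_snd
  | |- computable (fun x => andb _ _) => apply: computable_andb
  | |- computable (fun x => orb _ _) => apply: computable_orb
  | |- computable (fun x => eq_op _ _) => apply: computable_eq
  | |- computable (fun x => leq _ _) => apply: computable_leq
  | |- computable (fun x => S _) => apply: computable_succ
  | |- computable (fun x => all _ _) => apply: computable_all
  | |- computable (fun x => iota 0 _) => apply: computable_iota
  | |- computable (fun x => foldl _ _ _) => apply: computable_foldl
  | |- computable (fun x => nth _ _ _) => apply: computable_nth
  | |- computable (fun x => cat _ _) => apply: computable_cat
  | |- computable (fun x => cons _ _) => apply: computable_cons
  | |- computable (fun x => map _ _) => apply: computable_map
  | |- computable (fun x => flatten _) => apply: computable_flatten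
  | |- computable (fun x => enc _) => apply: computable_enc
  | |- computable (fun x => @linv ?A _) => apply: (computable_letter (@linv A))
  | |- computable (fun x => if _ then _ else _) => apply: computable_if
  | |- computable (fun x => ?f _) => apply: (computable_comp (g := f)); first assumption
  end]).

Section Certificates.
Variables (A : finType) (R : seq (word A * word A)).
Local Notation word := (seq (letter A)).

(** Lists of numbers have a surjective coding, words do not. With [letters] as table this decodes
    certificates; with other tables it translates words over another generating set. A number out of
    range gives the empty word. *)
Definition subst (t : seq word) (s : seq nat) : word := flatten [seq nth [::] t i | i <- s].

Definition letters : seq word := [seq [:: a] | a <- enum {: letter A}].

Lemma subst_letters (w : word) : subst letters [seq enc a | a <- w] = w.
Proof.
rewrite /subst; elim: w => //= a w ->; rewrite /letters (nth_map a) ?nth_enum_rank //.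
by rewrite -cardE ltn_ord.
Qed.

Definition step_code : Type := ((seq nat * seq nat) * ((seq nat * seq nat) * nat))%type.

Definition decode_step (s : step_code) : rewriting_step A :=
  ((subst letters s.1.1, subst letters s.1.2),
   ((subst letters s.2.1.1, subst letters s.2.1.2), s.2.2)).

Definition encode_step (s : rewriting_step A) : step_code :=
  (([seq enc a | a <- s.1.1], [seq enc a | a <- s.1.2]),
   (([seq enc a | a <- s.2.1.1], [seq enc a | a <- s.2.1.2]), s.2.2)).

Lemma encode_stepK : cancel encode_step decode_step.
Proof. by move=> [[a b] [[x y] k]]; rewrite /decode_step /= !subst_letters. Qed.

(** One type holds both kinds of evidence, so that one search covers both: a list of rewriting
    steps, then the number of states, the transition table and the start state of an automaton. *)
Definition certificate : Type := (seq step_code * (nat * (seq (seq nat) * nat)))%type.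

Definition certifies_eq (c : certificate) (u v : word) : bool :=
  foldl (rewrite_step R) u (map decode_step c.1) == v.

Definition certifies_neq (c : certificate) (u v : word) : bool :=
  [&& partially_injective A c.2.1 c.2.2.1, satisfies_relations R c.2.1 c.2.2.1,
      c.2.2.2 < c.2.1 &
      run c.2.1 c.2.2.1 c.2.2.2 u != run c.2.1 c.2.2.1 c.2.2.2 v].

Lemma computable_subst T (cT : coded T) t (s : T -> seq nat) :
  computable s -> computable (fun x => subst t (s x)).
Proof. by move=> cs; rewrite /subst; computes. Qed.

Lemma computable_winv T (cT : coded T) (w : T -> word) :
  computable w -> computable (fun x => winv (w x) : word).
Proof.
move=> cw; apply: computable_rev; apply: (computable_map (f := fun _ => @linv A)) => //.
by apply: (computable_letter (@linv A)); computes.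
Qed.

Lemma computable_rewrite_step T (cT : coded T) (w : T -> word) (s : T -> rewriting_step A) :
  computable w -> computable s -> computable (fun x => rewrite_step R (w x) (s x)).
Proof.
move=> cw cs.
have cx : computable (fun x => winv (s x).2.1.1 : word) by apply: computable_winv; computes.
have cy : computable (fun x => winv (s x).2.1.2 : word) by apply: computable_winv; computes.
have cR : computable (fun x => rewriting_rules R (s x).2.1.1 (s x).2.1.2).
  by rewrite /rewriting_rules /word_relations; computes.
by rewrite /rewrite_step; computes.
Qed.

Lemma computable_run T (cT : coded T) n t q (w : T -> word) :
  computable n -> computable t -> computable q -> computable w ->
  computable (fun x => run (n x) (t x) (q x) (w x)).
Proof. by move=> cn ct cq cw; rewrite /run /transition; computes. Qed.

Lemma computable_certifies_eq T (cT : coded T) (c : T -> certificate) (u v : T -> word) :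
  computable c -> computable u -> computable v ->
  computable (fun x => certifies_eq (c x) (u x) (v x)).
Proof.
move=> cc cu cv.
have cd : computable (fun p : T * step_code => decode_step p.2).
  by rewrite /decode_step; do 4?[apply: computable_pair];
     try apply: computable_subst; computes.
have ce : computable (fun p : T * (word * rewriting_step A) => rewrite_step R p.2.1 p.2.2).
  by apply: computable_rewrite_step; computes.
apply: computable_eq => //; apply: (computable_foldl (f := fun _ => rewrite_step R)) => //.
by apply: (computable_map (f := fun _ => decode_step)) => //; computes.
Qed.

Lemma computable_certifies_neq T (cT : coded T) (c : T -> certificate) (u v : T -> word) :
  computable c -> computable u -> computable v ->
  computable (fun x => certifies_neq (c x) (u x) (v x)).
Proof.
move=> cc cu cv; rewrite /certifies_neq.
apply: computable_andb; first by rewrite /partially_injective /transition; computes.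
apply: computable_andb.
  apply: computable_all; last exact: computable_const.
  apply: computable_all; last by computes.
  by apply: computable_eq; apply: computable_run; computes.
apply: computable_andb; first by computes.
by apply/computable_negb/computable_eq; apply: computable_run; computes.
Qed.

Lemma enc_surj_certificate : enc_surj certificate.
Proof. by do ?[apply: enc_surj_nat | apply: enc_surj_prod | apply: enc_surj_seq]. Qed.

Lemma computable_image_eq (M : monoidType) (P : word -> M) (t : seq word) :
  P [::] = 1%g -> (forall u v, P (u ++ v) = (P u * P v)%g) ->
  (forall u v, P u = P v <-> inv_cong (fun u v => (u, v) \in R) u v) ->
  finite_J_above M ->
  computable (fun uv : seq nat * seq nat => P (subst t uv.1) == P (subst t uv.2)).
Proof.
move=> P1 PM PE hJ.
pose p (c : certificate) (uv : seq nat * seq nat) :=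
  certifies_eq c (subst t uv.1) (subst t uv.2) ||
  certifies_neq c (subst t uv.1) (subst t uv.2).
have eq_sound c u v : certifies_eq c u v -> P u = P v.
  by move=> /eqP uv; apply/PE/derivableP; exists [seq decode_step s | s <- c.1].
have neq_sound c u v : certifies_neq c u v -> P u <> P v.
  case/and4P=> inj rel lt_q /eqP neq /PE uv; apply: neq.
  exact: (run_cong inj rel uv (ltnW lt_q)).
have p_total uv : exists c, p c uv.
  rewrite /p; move: (subst t uv.1) (subst t uv.2) => u v.
  have [/PE/derivableP[ss ssE]|/eqP neq] := eqVneq (P u) (P v).
    exists ([seq encode_step s | s <- ss], (0, ([::], 0))).
    by rewrite /certifies_eq /= (mapK encode_stepK) ssE eqxx.
  have [n [tr [q [inj rel lt_q sep]]]] := exists_separation P1 PM PE hJ neq.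
  by exists ([::], (n, (tr, q))); rewrite orbC /certifies_neq /= inj rel lt_q sep.
have cp : computable (fun q : certificate * (seq nat * seq nat) => p q.1 q.2).
  by apply: computable_orb;
     [apply: computable_certifies_eq | apply: computable_certifies_neq];
     try apply: (computable_subst t); computes.
have sT : enc_surj (seq nat * seq nat).
  by do ?[apply: enc_surj_nat | apply: enc_surj_prod | apply: enc_surj_seq].
have [c cc pc] := computable_search sT enc_surj_certificate cp p_total.
(* Once a certificate is found, the answer is whether it certifies equality: for equal images,
   soundness excludes the other kind. *)
have cd : computable (fun uv => certifies_eq (c uv) (subst t uv.1) (subst t uv.2)).
  by apply: computable_certifies_eq => //; apply: (computable_subst t); computes.
apply: computable_ext cd _ => uv; apply/idP/eqP => [|eq_uv]; first exact: eq_sound.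
by have /orP[//|/neq_sound] := pc uv.
Qed.

End Certificates.

(** * The word problem over an arbitrary finite generating set *)

Theorem proposition3p8 (M : monoidType)
    (hfp : finitely_presented_inverse_monoid M)
    (hJ : finite_J_above M) :
  solvable_word_problem M.
Proof.
case: hfp => _ [A [R [f [g fK gK]]]] X phi _.
pose P (w : seq (letter A)) : M := f (inv_class (fun u v => (u, v) \in R) w).
have P1 : P [::] = 1%g by exact: (gmulf1 (s := f)).
have PM u v : P (u ++ v) = (P u * P v)%g.
  by rewrite /P -gmulfM; congr (f _); exact/esym/inv_mul_class.
have PE u v : P u = P v <-> inv_cong (fun u v => (u, v) \in R) u v.
  split=> [/(can_inj fK)/inv_classP //|uv].
  by rewrite /P; congr (f _); apply/inv_classP.
have P_surj m : exists w, P w = m.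
  by have [w wE] := inv_class_surj (g m); exists w; rewrite /P wE gK.
(* Each letter over [X] is represented by some word over [A]. As there are finitely many letters,
   the table [t] of these words is a constant of the algorithm. *)
have /choice[sigma sigmaE] : forall x : letter X, exists w, P w = phi [:: x].
  by move=> x; exact: P_surj.
pose t := [seq sigma x | x <- enum {: letter X}].
pose ranks (w : word X) : seq nat := [seq nat_of_ord (enum_rank x) | x <- w].
have phiE w : P (subst t (ranks w)) = phi w.
  elim: w => [|x w IHw]; first by rewrite [LHS]P1; exact/esym/(gmulf1 (s := phi)).
  rewrite [subst _ _]/= PM [P (flatten _)]IHw (nth_map x) -?cardE ?ltn_ord //.
  by rewrite nth_enum_rank sigmaE -gmulfM.
have [F rF FE] := computable_image_eq t P1 PM PE hJ.
exists (fun v : 2.-tuple nat => F (npair (nth 0 v 0) (nth 0 v 1))); split.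
  exact: (rec1_comp rF rec2_npair).
move=> u v /=.
(* The coding of [nat] is the identity, so [word_code w] is literally the code of the list
   [ranks w]. *)
have codeE w : word_code w = CodeSeq.code (map id (ranks w)) by rewrite map_id.
by rewrite !codeE (FE (ranks u, ranks v)) !phiE.
Qed.
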